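(* The map $E\to\mathbb{R}$ given by $$x\mapsto \|x\|_{\mathbf{hu}} := \mathbf{p}_{\mathbf{u}}(x^+)+\mathbf{p}_{\mathbf{u}}(x^-)$$ is a norm on $E$. Furthermore, for all $x,y\in E$, $\|x\vee y\|_{\mathbf{hu}}\le \max\{\|x\|_{\mathbf{hu}},\|y\|_{\mathbf{hu}}\}$, with equality if both $x$ and $y$ are in $E_+$; and for all $x\in E$, $$\|x\|_{\mathbf{hu}}=\|x^+\|_{\mathbf{hu}}+\|x^-\|_{\mathbf{hu}}=\|x^+\|_{\mathbf{u}}+\|x^-\|_{\mathbf{u}}.$$
   Context: $E\neq\{0\}$ is an Archimedean Riesz space (real vector lattice), with order $\leqslant$, lattice operations $\vee,\wedge$, positive cone $E_+=\{x\in E:0\leqslant x\}$. Archimedean means: if $ny\leqslant x$ for all $n\in\mathbb{N}$ then $y\leqslant 0$. Notation: $x^+=x\vee 0$, $x^-=(-x)\vee 0$, $|x|=x\vee(-x)$. The element $\mathbf{u}\in E_+$ is a (strong order) unit: for every $x\in E_+$ there is $n\in\mathbb{N}$ with $x\leqslant n\mathbf{u}$. For $x\in E$, $\mathbf{p}_{\mathbf{u}}(x)=\inf\{t\in\mathbb{R}: x\leqslant t\mathbf{u}\}$ and $\|x\|_{\mathbf{u}}=\inf\{t\geq 0: |x|\leqslant t\mathbf{u}\}$ (these are real numbers, and $\|\cdot\|_{\mathbf{u}}$ is a norm on $E$). *)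

(* Defs.v *)
From HB Require Import structures.
From mathcomp Require Import all_boot all_order all_algebra.
From mathcomp Require Import boolp classical_sets reals.

Set Implicit Arguments.
Unset Strict Implicit.
Unset Printing Implicit Defensive.

Import Order.TTheory GRing.Theory Num.Theory.

Local Open Scope ring_scope.

(* The lattice operations are part of the structure, rather than inherited from
   [latticeType], because the hierarchy already reserves [realDomainType] as the
   join of [latticeType] and the additive structures. *)
HB.mixin Record POrderedLmodule_isRiesz (R : numDomainType) E
    of Num.POrderedZmodule E & GRing.Lmodule R E := {
  riesz_lerD2r : forall z x y : E, x <= y -> x + z <= y + z;
  riesz_scaler_ge0 : forall (a : R) (x : E), 0 <= a -> 0 <= x -> 0 <= a *: x;
  riesz_join : E -> E -> E;
  riesz_meet : E -> E -> E;
  riesz_leUx : forall x y z : E,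
    (riesz_join x y <= z) = (x <= z) && (y <= z);
  riesz_lexI : forall x y z : E,
    (z <= riesz_meet x y) = (z <= x) && (z <= y)
}.

#[short(type="rieszType")]
HB.structure Definition Riesz (R : numDomainType) :=
  { E of Num.POrderedZmodule E & GRing.Lmodule R E
       & POrderedLmodule_isRiesz R E }.

Section RieszDefs.
Variables (R : realType) (E : rieszType R).
Implicit Types (u x y : E) (f : E -> R).

Definition riesz_archimedean : Prop :=
  forall x y, (forall n : nat, y *+ n <= x) -> y <= 0.

Definition pos_part x : E := riesz_join x 0.
Definition neg_part x : E := riesz_join (- x) 0.
Definition abs_val x : E := riesz_join x (- x).

Definition order_unit u : Prop :=
  0 <= u /\ forall x, 0 <= x -> exists n : nat, x <= u *+ n.

(* [inf] is [0] by convention on a set that is empty or unbounded below.  When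
   [E] is Archimedean and not reduced to [0] and [u] is an order unit, neither
   case occurs in the next two definitions. *)
Definition gauge u x : R := inf [set t : R | x <= t *: u]%classic.

Definition unit_norm u x : R :=
  inf [set t : R | 0 <= t /\ abs_val x <= t *: u]%classic.

Definition hu_norm u x : R := gauge u (pos_part x) + gauge u (neg_part x).

Definition is_norm f : Prop :=
  [/\ forall x, 0 <= f x,
      forall x, f x = 0 -> x = 0,
      forall (a : R) x, f (a *: x) = `|a| * f x
    & forall x y, f (x + y) <= f x + f y].

End RieszDefs.

Arguments riesz_archimedean {R} E.

(* Main.v *)
Require Import Defs.
From mathcomp Require Import all_boot all_order all_algebra.
From mathcomp Require Import boolp classical_sets reals.

Set Implicit Arguments.
Unset Strict Implicit.
Unset Printing Implicit Defensive.

Import Order.TTheory GRing.Theory Num.Theory.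

Local Open Scope ring_scope.

(** The Archimedean property makes the infimum defining the gauge of a positive
    element [x] attained, so that [x <= t *: u] holds exactly when
    [gauge u x <= t] (lemma [le_gauge]).  Thus, on the positive cone, the gauge
    is left adjoint to [t |-> t *: u], and its properties there are formal: it
    is nonnegative, definite, monotone, subadditive, positively homogeneous, and
    turns binary joins into maxima.

    The norm axioms for [x |-> gauge u (pos_part x) + gauge u (neg_part x)]
    follow because the positive and negative parts are sublinear functions of
    [x], exchanged by [x |-> - x], and vanish together only at [0].  For the
    join, the positive part of [x \/ y] is the join of the positive parts, while
    its negative part lies below both negative parts; so the first gauge is a
    maximum [max a b], the second is at most [c] and at most [d], and the sum is
    at most [max (a + c) (b + d)].  On the positive cone both norms are just the
    gauge, which gives the two remaining claims. *)

(** Comparing upper bounds is how joins, which are known only through their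
    universal property, and gauges get identified. *)
Lemma eq_upper_bounds (d : Order.disp_t) (T : porderType d) (x y : T) :
  (forall z, (x <= z)%O = (y <= z)%O) -> x = y.
Proof. by move=> xy; apply/le_anti; rewrite xy lexx -xy lexx. Qed.

(** * Order, positive parts and negative parts in a Riesz space *)

Section RieszTheory.
Variables (R : realType) (E : rieszType R).
Implicit Types (x y z : E) (a : R).

Lemma riesz_leD2r z x y : (x + z <= y + z) = (x <= y).
Proof.
apply/idP/idP => [/(riesz_lerD2r (- z))|]; last exact: riesz_lerD2r.
by rewrite !addrK.
Qed.

Lemma riesz_subr_ge0 x y : (0 <= y - x) = (x <= y).
Proof. by rewrite -[LHS](riesz_leD2r x) add0r subrK. Qed.

Lemma riesz_leN2 x y : (- x <= - y) = (y <= x).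
Proof. by rewrite -[LHS]riesz_subr_ge0 opprK addrC riesz_subr_ge0. Qed.

Lemma riesz_leD x y z t : x <= y -> z <= t -> x + z <= y + t.
Proof.
move=> xy zt; apply: (@le_trans _ _ (y + z)); first by rewrite riesz_leD2r.
by rewrite ![y + _]addrC riesz_leD2r.
Qed.

Lemma riesz_leZ2l a x y : 0 < a -> (a *: x <= a *: y) = (x <= y).
Proof.
have scale_homo b (s t : E) : 0 < b -> s <= t -> b *: s <= b *: t.
  move=> /ltW b0; rewrite -riesz_subr_ge0 => st.
  by rewrite -riesz_subr_ge0 -scalerBr riesz_scaler_ge0.
move=> a0; apply/idP/idP; last exact: scale_homo.
move=> /(scale_homo a^-1); rewrite invr_gt0 => /(_ a0).
by rewrite !scalerA mulVf ?gt_eqF // !scale1r.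
Qed.

Lemma riesz_leZl a x z : 0 < a -> (a *: x <= z) = (x <= a^-1 *: z).
Proof.
move=> a0; rewrite -[RHS](@riesz_leZ2l a) //.
by rewrite scalerA mulfV ?gt_eqF // scale1r.
Qed.

Lemma riesz_leUl x y : x <= riesz_join x y.
Proof. by have := lexx (riesz_join x y); rewrite riesz_leUx => /andP[]. Qed.

Lemma riesz_leUr x y : y <= riesz_join x y.
Proof. by have := lexx (riesz_join x y); rewrite riesz_leUx => /andP[]. Qed.

Lemma riesz_join_l x y : y <= x -> riesz_join x y = x.
Proof.
move=> yx; apply: eq_upper_bounds => z; rewrite riesz_leUx.
by apply/andP/idP => [[]//|xz]; split=> //; exact: le_trans yx xz.
Qed.

Lemma riesz_join_r x y : x <= y -> riesz_join x y = y.
Proof.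
move=> xy; apply: eq_upper_bounds => z; rewrite riesz_leUx.
by apply/andP/idP => [[]//|yz]; split=> //; exact: le_trans xy yz.
Qed.

Lemma pos_part_ge0 x : 0 <= pos_part x. Proof. exact: riesz_leUr. Qed.

Lemma neg_part_ge0 x : 0 <= neg_part x. Proof. exact: riesz_leUr. Qed.

Lemma pos_part_id x : 0 <= x -> pos_part x = x.
Proof. exact: riesz_join_l. Qed.

Lemma neg_part_eq0 x : 0 <= x -> neg_part x = 0.
Proof. by move=> x0; rewrite /neg_part riesz_join_r // -oppr0 riesz_leN2. Qed.

Lemma pos_partN x : pos_part (- x) = neg_part x. Proof. by []. Qed.

Lemma neg_partN x : neg_part (- x) = pos_part x.
Proof. by rewrite /neg_part opprK. Qed.

Lemma pos_part_le0 x : pos_part x = 0 -> x <= 0.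
Proof. by move=> <-; exact: riesz_leUl. Qed.

Lemma pos_partD x y : pos_part (x + y) <= pos_part x + pos_part y.
Proof.
rewrite riesz_leUx riesz_leD ?riesz_leUl //= -[0]addr0.
by rewrite riesz_leD ?pos_part_ge0.
Qed.

Lemma neg_partD x y : neg_part (x + y) <= neg_part x + neg_part y.
Proof. by rewrite -!pos_partN opprD pos_partD. Qed.

Lemma pos_partZ a x : 0 < a -> pos_part (a *: x) = a *: pos_part x.
Proof.
move=> a0; apply: eq_upper_bounds => z.
by rewrite riesz_leZl // !riesz_leUx -!riesz_leZl // scaler0.
Qed.

Lemma neg_partZ a x : 0 < a -> neg_part (a *: x) = a *: neg_part x.
Proof. by move=> a0; rewrite -!pos_partN -scalerN pos_partZ. Qed.

Lemma pos_part_join x y :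
  pos_part (riesz_join x y) = riesz_join (pos_part x) (pos_part y).
Proof.
by apply: eq_upper_bounds => z; rewrite !riesz_leUx andbACA andbb.
Qed.

Lemma neg_part_anti x y : x <= y -> neg_part y <= neg_part x.
Proof.
move=> xy; rewrite riesz_leUx neg_part_ge0 andbT.
by apply: le_trans (riesz_leUl _ _); rewrite riesz_leN2.
Qed.

Lemma abs_val_id x : 0 <= x -> abs_val x = x.
Proof.
move=> x0; apply: riesz_join_l; apply: (le_trans _ x0).
by rewrite -oppr0 riesz_leN2.
Qed.

(** In the trivial space every real number would be admissible in the infimum
    defining the gauge; this is what excludes that case. *)
Lemma order_unit_neq0 (u : E) :
  (exists x, x != 0) -> order_unit u -> u != 0.
Proof.
case=> x xN0 [_ u_unit]; apply: contra_neq xN0 => u0.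
have le0 y : y <= 0.
  apply: le_trans (riesz_leUl y 0) _.
  by have [n] := u_unit _ (pos_part_ge0 y); rewrite u0 mul0rn.
by apply/le_anti; rewrite le0 -oppr0 -[x]opprK riesz_leN2 le0.
Qed.

End RieszTheory.

(** * The gauge of an order unit on the positive cone *)

Section Gauge.
Variables (R : realType) (E : rieszType R).
Hypothesis E_arch : riesz_archimedean E.
Variable u : E.
Hypotheses (u_unit : order_unit u) (u_neq0 : u != 0).
Implicit Types (x y : E) (t a : R).

Lemma unit_scale_ge0 t : (0 <= t *: u) = (0 <= t).
Proof.
have [u_ge0 _] := u_unit; apply/idP/idP => [tu|t0]; last exact: riesz_scaler_ge0.
rewrite leNgt; apply: contra_neqN u_neq0 => t_lt0; apply/le_anti.
rewrite u_ge0 andbT -(@riesz_leZ2l _ _ (- t)) ?oppr_gt0 //.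
by rewrite scaler0 scaleNr -oppr0 riesz_leN2.
Qed.

Lemma unit_scale_mono s t : s <= t -> s *: u <= t *: u.
Proof. by rewrite -riesz_subr_ge0 -scalerBl unit_scale_ge0 subr_ge0. Qed.

(** The set of admissible [t] is closed: being admissible up to [n.+1^-1] for
    all [n] means [n.+1 *: (x - t *: u) <= u], so that [x - t *: u <= 0] by the
    Archimedean property. *)
Lemma le_unit_scale_closed x t :
  (forall s, t < s -> x <= s *: u) -> x <= t *: u.
Proof.
move=> xs; rewrite -(riesz_leD2r (- (t *: u))) subrr.
apply: (E_arch (x := u)) => -[|n]; first by case: u_unit; rewrite mulr0n.
rewrite -scaler_nat riesz_leZl ?ltr0Sn //.
rewrite -(riesz_leD2r (t *: u)) subrK -scalerDl.
by apply: xs; rewrite ltrDr invr_gt0 ltr0Sn.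
Qed.

(** The positivity of [x] bounds the admissible [t] below by [0], the order unit
    provides one of them, and closedness makes the infimum admissible. *)
Lemma le_gauge x t : 0 <= x -> (x <= t *: u) = (gauge u x <= t).
Proof.
move=> x0; pose A := [set s : R | x <= s *: u]%classic.
have lbA : has_lbound A.
  by exists 0 => s /(le_trans x0); rewrite unit_scale_ge0.
have infA : has_inf A.
  split=> //; have [_ /(_ x x0)[n xn]] := u_unit.
  by exists n%:R; rewrite /A /= scaler_nat.
apply/idP/idP => [xt|gt]; first exact: ge_inf.
apply: le_unit_scale_closed => s ts.
have [r xr rs] := inf_lt (proj1 infA) (le_lt_trans gt ts).
exact: le_trans xr (unit_scale_mono (ltW rs)).
Qed.

Lemma gauge_le x : 0 <= x -> x <= gauge u x *: u.
Proof. by move=> x0; rewrite le_gauge. Qed.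

Lemma gauge_ge0 x : 0 <= x -> 0 <= gauge u x.
Proof. by move=> x0; rewrite -unit_scale_ge0 (le_trans x0) // gauge_le. Qed.

Lemma gauge0 : gauge u 0 = 0.
Proof.
by apply/le_anti; rewrite gauge_ge0 // -le_gauge // scale0r lexx.
Qed.

Lemma gauge_eq0 x : 0 <= x -> gauge u x = 0 -> x = 0.
Proof.
move=> x0 gx; apply/le_anti.
by rewrite x0 -[X in _ <= X](scale0r u) le_gauge // gx lexx.
Qed.

Lemma gauge_mono x y : 0 <= x -> x <= y -> gauge u x <= gauge u y.
Proof.
by move=> x0 xy; rewrite -le_gauge // (le_trans xy) // gauge_le // (le_trans x0).
Qed.

Lemma gaugeD x y : 0 <= x -> 0 <= y -> gauge u (x + y) <= gauge u x + gauge u y.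
Proof.
move=> x0 y0; rewrite -le_gauge; last by rewrite -[0]addr0 riesz_leD.
by rewrite scalerDl riesz_leD ?gauge_le.
Qed.

Lemma gaugeZ a x : 0 < a -> 0 <= x -> gauge u (a *: x) = a * gauge u x.
Proof.
move=> a0 x0; apply: eq_upper_bounds => t.
rewrite -le_gauge; last exact: riesz_scaler_ge0 (ltW a0) x0.
rewrite riesz_leZl // scalerA le_gauge //.
by rewrite ler_pdivlMl.
Qed.

Lemma gauge_join x y : 0 <= x -> 0 <= y ->
  gauge u (riesz_join x y) = Num.max (gauge u x) (gauge u y).
Proof.
move=> x0 y0; apply: eq_upper_bounds => t; rewrite ge_max -!le_gauge //.
  exact: riesz_leUx.
exact: le_trans x0 (riesz_leUl x y).
Qed.

(** * The norm obtained by adding the gauges of both parts *)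

Lemma unit_norm_gauge x : 0 <= x -> unit_norm u x = gauge u x.
Proof.
move=> x0; rewrite /unit_norm /gauge abs_val_id //; congr inf.
apply/seteqP; split=> t /= => [[]//|xt]; split=> //.
by rewrite -unit_scale_ge0 (le_trans x0).
Qed.

Lemma hu_norm_gauge x : 0 <= x -> hu_norm u x = gauge u x.
Proof.
by move=> x0; rewrite /hu_norm pos_part_id // neg_part_eq0 // gauge0 addr0.
Qed.

Lemma hu_normN x : hu_norm u (- x) = hu_norm u x.
Proof. by rewrite /hu_norm pos_partN neg_partN addrC. Qed.

Lemma hu_normZ_gt0 a x : 0 < a -> hu_norm u (a *: x) = a * hu_norm u x.
Proof.
move=> a0; rewrite /hu_norm pos_partZ // neg_partZ //.
by rewrite !gaugeZ ?pos_part_ge0 ?neg_part_ge0 // mulrDr.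
Qed.

Lemma hu_norm_is_norm : is_norm (hu_norm u).
Proof.
have gp x := gauge_ge0 (pos_part_ge0 x); have gn x := gauge_ge0 (neg_part_ge0 x).
split=> [x|x /eqP|a x|x y].
- exact: addr_ge0.
- rewrite paddr_eq0 // => /andP[/eqP/gauge_eq0 xp /eqP/gauge_eq0 xn].
  have xle0 := pos_part_le0 (xp (pos_part_ge0 x)).
  have xge0 : 0 <= x.
    by rewrite -riesz_leN2 oppr0; exact: pos_part_le0 (xn (neg_part_ge0 x)).
  by apply/le_anti; rewrite xle0 xge0.
- have [a_lt0|a_gt0|->] := ltgtP a 0.
  + by rewrite -hu_normN -scaleNr hu_normZ_gt0 ?oppr_gt0 // ltr0_norm.
  + by rewrite hu_normZ_gt0 // gtr0_norm.
  + by rewrite scale0r normr0 mul0r hu_norm_gauge // gauge0.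
- rewrite /hu_norm addrACA lerD //.
  + apply: le_trans (gauge_mono (pos_part_ge0 _) (pos_partD x y)) _.
    by rewrite gaugeD ?pos_part_ge0.
  + apply: le_trans (gauge_mono (neg_part_ge0 _) (neg_partD x y)) _.
    by rewrite gaugeD ?neg_part_ge0.
Qed.

Lemma hu_norm_join_le x y :
  hu_norm u (riesz_join x y) <= Num.max (hu_norm u x) (hu_norm u y).
Proof.
rewrite /hu_norm pos_part_join gauge_join ?pos_part_ge0 // addr_maxl.
have gn z : z <= riesz_join x y ->
    gauge u (neg_part (riesz_join x y)) <= gauge u (neg_part z).
  by move=> zxy; apply: gauge_mono (neg_part_ge0 _) (neg_part_anti zxy).
rewrite ge_max !le_max !lerD2l.
by rewrite gn ?riesz_leUl // gn ?riesz_leUr // orbT.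
Qed.

End Gauge.

Theorem theorem1 (R : realType) (E : rieszType R)
    (E_neq0 : exists x : E, x != 0)
    (E_arch : riesz_archimedean E)
    (u : E) (u_unit : order_unit u) :
  [/\ is_norm (hu_norm u),
      forall x y : E,
        hu_norm u (riesz_join x y) <= Num.max (hu_norm u x) (hu_norm u y),
      forall x y : E, 0 <= x -> 0 <= y ->
        hu_norm u (riesz_join x y) = Num.max (hu_norm u x) (hu_norm u y)
    & forall x : E,
        hu_norm u x = hu_norm u (pos_part x) + hu_norm u (neg_part x) /\
        hu_norm u (pos_part x) + hu_norm u (neg_part x) =
          unit_norm u (pos_part x) + unit_norm u (neg_part x)].
Proof.
have u_neq0 := order_unit_neq0 E_neq0 u_unit.
split=> [|x y|x y x0 y0|x].
- exact: hu_norm_is_norm.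
- exact: hu_norm_join_le.
- rewrite !hu_norm_gauge // ?gauge_join //.
  exact: le_trans x0 (riesz_leUl x y).
- have [xp xn] := (pos_part_ge0 x, neg_part_ge0 x).
  rewrite (hu_norm_gauge E_arch u_unit u_neq0 xp).
  rewrite (hu_norm_gauge E_arch u_unit u_neq0 xn).
  by rewrite !unit_norm_gauge.
Qed.
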